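(* Suppose the frequencies $\omega_1,\dots,\omega_s\in[0,1)$ satisfy $\omega_k\neq\omega_l$ for all $k\neq l$. If $L\ge s$ and $M-L+1\ge s$, then for every $\omega\in[0,1)$, $$\omega\in\mathcal S\iff R(\omega)=0\iff J(\omega)=\infty .$$
   Context: Setting. Let $s,L,M$ be positive integers with $1\le L<M$. Let $\mathcal S=\{\omega_1,\dots,\omega_s\}\subset[0,1)$ (the torus $\mathbb T=[0,1)$) be a set of frequencies and $x_1,\dots,x_s\in\mathbb C\setminus\{0\}$ amplitudes. For a nonnegative integer $N$ and $\omega\in\mathbb R$ put $\phi^{N}(\omega)=[1,\ e^{-2\pi i\omega},\ e^{-2\pi i2\omega},\dots,e^{-2\pi iN\omega}]^T\in\mathbb C^{N+1}$ and $\Phi^N=[\phi^N(\omega_1)\ \cdots\ \phi^N(\omega_s)]\in\mathbb C^{(N+1)\times s}$. The noiseless data are $y_k=\sum_{j=1}^s x_je^{-2\pi ik\omega_j}$, $k=0,\dots,M$, and $H\in\mathbb C^{(L+1)\times(M-L+1)}$ is the Hankel matrix with entries $H_{ab}=y_{a+b}$, $0\le a\le L$, $0\le b\le M-L$. Equivalently $H=\Phi^LX(\Phi^{M-L})^T$ with $X=\mathrm{diag}(x_1,\dots,x_s)$. Under the hypotheses $H$ has rank $s$; write its singular value decomposition as $H=[U_1\ U_2]\,\mathrm{diag}(\sigma_1,\dots,\sigma_s,0,\dots,0)\,[V_1\ V_2]^\star$ with $\sigma_1\ge\dots\ge\sigma_s>0$, $U_1\in\mathbb C^{(L+1)\times s}$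 and $U_2\in\mathbb C^{(L+1)\times(L+1-s)}$. Let $\mathcal P_2=U_2U_2^\star$ (orthogonal projection onto the noise space, i.e. the orthogonal complement of the range of $H$). The noise-space correlation function and the imaging function are $$R(\omega)=\frac{\|\mathcal P_2\phi^L(\omega)\|_2}{\|\phi^L(\omega)\|_2},\qquad J(\omega)=\frac{\|\phi^L(\omega)\|_2}{\|\mathcal P_2\phi^L(\omega)\|_2},$$ with $J(\omega)=\infty$ when the denominator vanishes. *)

(* Defs.v *)
From HB Require Import structures.
From mathcomp Require Import all_boot all_order all_algebra.
From mathcomp Require Import complex.
From mathcomp Require Import all_classical all_reals all_analysis.

Set Implicit Arguments.
Unset Strict Implicit.
Unset Printing Implicit Defensive.

Import Order.TTheory GRing.Theory Num.Theory.

Local Open Scope ring_scope.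
Local Open Scope complex_scope.
Local Open Scope sesquilinear_scope.

Section Defs.
Variable R : realType.

(* e^{i t} for real t, by Euler's formula *)
Definition expi (t : R) : R[i] := cos t +i* sin t.

Definition norm2 n (v : 'cV[R[i]]_n) : R :=
  Num.sqrt (\sum_(i < n) Normc.normc (v i 0) ^+ 2).

Definition phi (N : nat) (w : R) : 'cV[R[i]]_N.+1 :=
  \col_(k < N.+1) expi (- (2 * pi * k%:R * w)).

Definition data s (omega : 'I_s -> R) (x : 'I_s -> R[i]) (k : nat) : R[i] :=
  \sum_(j < s) x j * expi (- (2 * pi * k%:R * omega j)).

Definition hankel (L M : nat) (y : nat -> R[i]) :
    'M[R[i]]_(L.+1, (M - L).+1) :=
  \matrix_(a < L.+1, b < (M - L).+1) y (a + b)%N.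

(* The values of [sigma] beyond [minn m n] play no role.  No rank is prescribed:
   some of the singular values may vanish. *)
Definition is_svd m n (A : 'M[R[i]]_(m, n))
    (U : 'M[R[i]]_m) (sigma : nat -> R) (V : 'M[R[i]]_n) : Prop :=
  [/\ U \is unitarymx,
      V \is unitarymx,
      forall i, (i < minn m n)%N -> 0 <= sigma i,
      forall i j, (i <= j < minn m n)%N -> sigma j <= sigma i
    & A = U *m (\matrix_(i < m, j < n)
                  (if i == j :> nat then (sigma i)%:C else 0)) *m V^t*].

(* The last [L.+1 - s] columns of U; as [s + j < L.+1] for [j < L.+1 - s],
   [inord] does not truncate. *)
Definition noise_basis (s L : nat) (U : 'M[R[i]]_L.+1) :
    'M[R[i]]_(L.+1, L.+1 - s) :=
  colsub (fun j : 'I_(L.+1 - s) => inord (s + j)) U.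

Definition noise_proj (s L : nat) (U : 'M[R[i]]_L.+1) : 'M[R[i]]_L.+1 :=
  noise_basis s U *m (noise_basis s U)^t*.

Definition noise_corr (s L : nat) (U : 'M[R[i]]_L.+1) (w : R) : R :=
  norm2 (noise_proj s U *m phi L w) / norm2 (phi L w).

Definition imaging (s L : nat) (U : 'M[R[i]]_L.+1) (w : R) : \bar R :=
  if norm2 (noise_proj s U *m phi L w) == 0 then +oo%E
  else (norm2 (phi L w) / norm2 (noise_proj s U *m phi L w))%:E.

End Defs.

(* Main.v *)
(** Write [z_j = expi (- 2 pi omega_j)].  The Hankel matrix factors as
    [H = Phi^L X (Phi^{M-L})^T] with Vandermonde outer factors of full rank
    [s], so [H] has rank [s] and the same column space as [Phi^L].  Hence
    [sigma_i] vanishes for [i >= s], the columns of [U_2] annihilate [H], and,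
    comparing dimensions, [P_2 v = 0] exactly when [v] is in the column space
    of [Phi^L].  Since [s <= L], the polynomial [\prod_j ('X - z_j)] gives a
    linear form that vanishes on this space, and its value at [phi^L(w)] is
    [\prod_j (z - z_j)] with [z = expi (- 2 pi w)]. *)
Require Import Defs.
From HB Require Import structures.
From mathcomp Require Import all_boot all_order all_algebra.
From mathcomp Require Import complex.
From mathcomp Require Import all_classical all_reals all_analysis.
From mathcomp Require Import ring lra.

Set Implicit Arguments.
Unset Strict Implicit.
Unset Printing Implicit Defensive.

Import Order.TTheory GRing.Theory Num.Theory.
Local Open Scope classical_set_scope.
Local Open Scope ring_scope.
Local Open Scope sesquilinear_scope.

(** Turns linear forms on the columns of a Vandermonde matrix into polynomials evaluated at the
    nodes. *)
Lemma poly_rV_mul_Vandermonde (F : comNzRingType) n s (p : {poly F})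
    (a : 'rV[F]_s) :
  (size p <= n)%N -> poly_rV p *m Vandermonde n a = \row_j p.[a 0 j].
Proof.
move=> le_pn; apply/rowP => j; rewrite !mxE (horner_coef_wide _ le_pn).
by apply: eq_bigr => k _; rewrite !mxE.
Qed.

(** Lagrange interpolation: a polynomial vanishing at every node except [a 0 i] isolates the
    coefficient [v 0 i] of a linear dependence [v]. *)
Lemma tr_Vandermonde_row_free (F : fieldType) n s (a : 'rV[F]_s) :
  injective (a 0) -> (s <= n)%N -> row_free (Vandermonde n a)^T.
Proof.
move=> a_inj le_sn; apply: inj_row_free => v vV0; apply/rowP => i.
(* Omitting the factor at [i] leaves degree [s - 1], hence size [s], which fits in [n]
   coefficients. *)
pose p := \prod_(j <- rem i (index_enum 'I_s)) ('X - (a 0 j)%:P).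
have sz_p : (size p <= n)%N.
  rewrite size_prod_XsubC size_rem ?mem_index_enum //.
  rewrite -[index_enum _]enumT size_enum_ord.
  by rewrite prednK ?(leq_ltn_trans _ (ltn_ord i)).
have pE j : (p.[a 0 j] == 0) = (j != i).
  rewrite -[_ == 0]/(root p (a 0 j)).
  rewrite /p -(big_map (a 0) xpredT (fun z => 'X - z%:P)) root_prod_XsubC.
  by rewrite mem_map // mem_rem_uniq ?index_enum_uniq // inE mem_index_enum andbT.
have /matrixP/(_ 0 0) : v *m (poly_rV p *m Vandermonde n a)^T = 0.
  by rewrite trmx_mul mulmxA vV0 mul0mx.
rewrite poly_rV_mul_Vandermonde // !mxE (bigD1 i) //= big1 => [|j ji]; last first.
  have /eqP pj0 : p.[a 0 j] == 0 by rewrite pE.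
  by rewrite !mxE pj0 mulr0.
by rewrite !mxE addr0 => /eqP; rewrite mulf_eq0 pE eqxx orbF => /eqP.
Qed.

Lemma submx_tr_Vandermonde (F : fieldType) n s (a : 'rV[F]_s) (z : F) :
  (s < n)%N ->
  (\row_(k < n) z ^+ k <= (Vandermonde n a)^T)%MS <-> exists j, a 0 j = z.
Proof.
move=> lt_sn; split=> [/submxP[c zc] | [j <-]]; last first.
  have -> : \row_(k < n) a 0 j ^+ k = row j (Vandermonde n a)^T.
    by apply/rowP => k; rewrite !mxE.
  exact: row_sub.
(* All [s] nodes are roots here, so the size is [s.+1]; this is where [s < n] enters. *)
pose p := \prod_(j < s) ('X - (a 0 j)%:P).
have sz_p : (size p <= n)%N.
  by rewrite size_prod_XsubC -[index_enum _]enumT size_enum_ord.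
have rootp y : root p y = (y \in [seq a 0 j | j : 'I_s]).
  rewrite /p -(big_map (a 0) xpredT (fun z => 'X - z%:P)) root_prod_XsubC.
  by rewrite /image_mem enumT.
have pz : p.[z] = 0.
  (* Viewing [z] as a single node lets the same evaluation formula apply to it. *)
  have zV : \row_(k < n) z ^+ k = (Vandermonde n (\row_(_ < 1) z))^T.
    by apply/matrixP => i k; rewrite !mxE.
  have /matrixP/(_ 0 0) : (poly_rV p *m Vandermonde n (\row_(_ < 1) z))^T = 0.
    rewrite trmx_mul -zV zc -mulmxA -trmx_mul poly_rV_mul_Vandermonde //.
    rewrite (_ : \row_j _ = 0) ?trmx0 ?mulmx0 //; apply/rowP => j; rewrite !mxE.
    by apply/eqP; rewrite -[_ == 0]/(root p _) rootp map_f ?mem_enum.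
  by rewrite poly_rV_mul_Vandermonde // !mxE.
have : root p z by rewrite /root pz.
by rewrite rootp => /mapP[j _ ->]; exists j.
Qed.

Section ComplexExponential.
Variable R : realType.

Lemma expi0 : expi (0 : R) = 1.
Proof. by rewrite /expi cos0 sin0. Qed.

Lemma expiD (t u : R) : expi (t + u) = expi t * expi u.
Proof.
by rewrite /expi cosD sinD [sin t * cos u + _]addrC.
Qed.

Lemma expiMn (t : R) k : expi (t * k%:R) = expi t ^+ k.
Proof.
elim: k => [|k IHk]; first by rewrite mulr0 expi0.
by rewrite -natr1 mulrDr mulr1 expiD IHk exprSr.
Qed.

Lemma expi_2pi_inj (v w : R) : 0 <= v < 1 -> 0 <= w < 1 ->
  expi (- (2 * pi * v)) = expi (- (2 * pi * w)) -> v = w.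
Proof.
wlog le_vw : v w / v <= w => [hw|] v01 w01 e.
  by have [/hw|/ltW/hw->] := leP v w => //; apply.
case: e; rewrite !cosN !sinN => ecos /oppr_inj esin.
apply/eqP; rewrite eq_le le_vw /= leNgt; apply/negP => lt_vw.
(* Here [pi * (w - v)] lies strictly between 0 and [pi], whereas equal exponentials force the cosine
   of twice this angle to be 1, hence its sine to be 0. *)
have : sin (pi * (w - v)) > 0.
  have pi0 := pi_gt0 R.
  apply: sin_gt0_pi; rewrite mulr_gt0 ?subr_gt0 //=.
  by rewrite -[ltRHS]mulr1 ltr_pM2l //; lra.
have : cos (2 * pi * w - 2 * pi * v) = 1.
  by rewrite cosB ecos esin -!expr2 cos2Dsin2.
have -> : 2 * pi * w - 2 * pi * v = (pi * (w - v)) *+ 2 by ring.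
rewrite cos_mulr2n cos2sin2 => h /lt0r_neq0/negP; apply.
rewrite -sqrf_eq0; apply/eqP; lra.
Qed.

End ComplexExponential.

Lemma norm2_eq0 (R : realType) n (v : 'cV[R[i]]_n) : (norm2 v == 0) = (v == 0).
Proof.
have norm_ge0 i : 0 <= Normc.normc (v i 0) ^+ 2 by rewrite sqr_ge0.
rewrite /norm2 sqrtr_eq0 le_eqVlt ltNge sumr_ge0 // orbF.
rewrite psumr_eq0 //; apply/allP/eqP => [v0 | -> i _].
  apply/colP => i; have := v0 i (mem_index_enum i).
  by rewrite sqrf_eq0 => /eqP/Normc.eq0_normc ->; rewrite mxE.
by rewrite mxE Normc.normc0 expr0n eqxx.
Qed.

Section SVD.
Variable R : realType.

(* [s.+1] nonzero singular values would give an invertible minor of order [s.+1]. *)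
Lemma svd_rank_sigma0 m n (A : 'M[R[i]]_(m, n)) U sigma V s i :
  is_svd A U sigma V -> \rank A = s -> (s <= i < minn m n)%N -> sigma i = 0.
Proof.
case=> U_unit V_unit sigma_ge0 sigma_le defA rkA /andP[le_si lt_i].
have lt_s := leq_ltn_trans le_si lt_i.
have [sm sn] : (s < m)%N /\ (s < n)%N by apply/andP; rewrite -leq_min.
suff sigma_s : sigma s = 0.
  by apply/le_anti; rewrite sigma_ge0 // andbT -sigma_s sigma_le ?le_si.
apply/eqP/negPn/negP => sigma_s.
have sigma_neq0 k : (k < s.+1)%N -> sigma k != 0.
  rewrite ltnS => le_ks; apply: lt0r_neq0.
  by rewrite (lt_le_trans _ (sigma_le k s _)) ?le_ks // lt0r sigma_s sigma_ge0.
move: defA; set D := \matrix_(_, _) _ => defA.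
have rkD : \rank D = s.
  rewrite -rkA defA mxrankMfree ?row_free_unit ?unitarymx_unit ?trmxC_unitary //.
  by rewrite eqmxMfull // row_full_unit unitarymx_unit.
pose d := \row_(k < s.+1) (sigma k)%:C%C.
(* The leading minor of [D] is cut out by selection matrices, so its rank is at most that of [D]. *)
have defd :
    diag_mx d = rowsub (widen_ord sm) 1%:M *m D *m colsub (widen_ord sn) 1%:M.
  rewrite mul_rowsub_mx mul1mx mulmx_colsub mulmx1 -mxsubcr.
  by apply/matrixP => j k; rewrite !mxE -val_eqE /=; case: eqP.
have : (\rank (diag_mx d) <= s)%N.
  by rewrite defd -[leqRHS]rkD (leq_trans (mxrankM_maxl _ _)) ?mxrankM_maxr.
rewrite mxrank_unit ?ltnn // unitmxE unitfE det_diag.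
by apply/prodf_neq0 => k _; rewrite mxE fmorph_eq0 sigma_neq0.
Qed.

Lemma noise_basis_unitary s L (U : 'M[R[i]]_L.+1) :
  U \is unitarymx -> (noise_basis s U)^t* *m noise_basis s U = 1%:M.
Proof.
move=> /unitarymxP/mulmx1C UU.
rewrite /noise_basis trmx_mxsub map_mxsub -mxsub_mul UU.
apply/matrixP => j k; rewrite !mxE -val_eqE /= !inordK ?eqn_add2l //.
  by have := ltn_ord k; rewrite ltn_subRL.
by have := ltn_ord j; rewrite ltn_subRL.
Qed.

(** The noise basis has orthonormal columns, so it is injective and can be cancelled on the left. *)
Lemma noise_proj_eq0 s L (U : 'M[R[i]]_L.+1) (v : 'cV_L.+1) :
  U \is unitarymx ->
  noise_proj s U *m v = 0 <-> (noise_basis s U)^t* *m v = 0.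
Proof.
move=> U_unit; rewrite /noise_proj -mulmxA; split=> [Pv0|->]; last exact: mulmx0.
by rewrite -[LHS]mul1mx -(noise_basis_unitary s U_unit) -mulmxA Pv0 mulmx0.
Qed.

(** Transposes appear because [<=] compares row spaces: the right side says that [v] is in the
    column space of [A]. *)
Lemma noise_proj_kernel s L n (A : 'M[R[i]]_(L.+1, n)) U sigma V
    (v : 'cV[R[i]]_L.+1) :
  is_svd A U sigma V -> \rank A = s ->
  noise_proj s U *m v = 0 <-> (v^T <= A^T)%MS.
Proof.
move=> svdA rkA; have [U_unit _ _ _ defA] := svdA.
rewrite noise_proj_eq0 //; set N := noise_basis s U.
have NA0 : N^t* *m A = 0.
  have NU : N^t* *m U = rowsub (fun j : 'I_(L.+1 - s) => inord (s + j)) 1%:M.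
    rewrite /N /noise_basis trmx_mxsub map_mxsub mul_rowsub_mx.
    by have /unitarymxP/mulmx1C -> := U_unit.
  rewrite defA !mulmxA NU mul_rowsub_mx mul1mx.
  (* Row [s + j] of the diagonal factor can only contain [sigma (s + j)], which is 0 by the rank
     assumption. *)
  rewrite (_ : rowsub _ _ = 0) ?mul0mx //; apply/matrixP => j k; rewrite !mxE.
  have lt_j : (s + j < L.+1)%N by have := ltn_ord j; rewrite ltn_subRL.
  rewrite inordK //; case: eqP => // jk.
  by rewrite (svd_rank_sigma0 svdA rkA) // leq_addr leq_min lt_j jk ltn_ord.
have le_sL : (s <= L.+1)%N by rewrite -rkA rank_leq_row.
have rkN : \rank (N^t*)^T = (L.+1 - s)%N.
  rewrite mxrank_tr; apply/eqP; rewrite -[_ == _]/(row_free (N^t*)); apply/row_freeP.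
  by exists N; apply: noise_basis_unitary.
have AN : (A^T <= kermx (N^t*)^T)%MS.
  by apply/sub_kermxP; rewrite -trmx_mul NA0 trmx0.
(* The inclusion is an equality since both ranks are [s]. *)
have /eqmxP eqAN : (A^T == kermx (N^t*)^T)%MS.
  by rewrite -(mxrank_leqif_eq AN) mxrank_tr mxrank_ker rkN rkA subKn.
rewrite eqAN; split=> [Nv0|/sub_kermxP].
  by apply/sub_kermxP; rewrite -trmx_mul Nv0 trmx0.
by rewrite -trmx_mul => /(congr1 trmx); rewrite trmxK trmx0.
Qed.

End SVD.

Section Hankel.
Variable R : realType.

Let node (t : R) : R[i] := expi (- (2 * pi * t)).

Lemma expi_node (k : nat) (t : R) : expi (- (2 * pi * k%:R * t)) = node t ^+ k.
Proof. by rewrite -expiMn; congr expi; ring. Qed.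

Lemma phi_neq0 N (w : R) : phi N w != 0.
Proof.
apply/eqP => /matrixP/(_ 0 0)/eqP.
by rewrite !mxE expi_node expr0 oner_eq0.
Qed.

Variables (s L M : nat) (omega : 'I_s -> R) (x : 'I_s -> R[i]).
Let H := hankel L M (data omega x).
Let a := \row_j node (omega j).

Lemma hankel_Vandermonde :
  H = Vandermonde L.+1 a *m diag_mx (\row_j x j) *m (Vandermonde (M - L).+1 a)^T.
Proof.
apply/matrixP => k l; rewrite mul_mx_diag !mxE /data; apply: eq_bigr => j _.
by rewrite expi_node !mxE exprD mulrA [x j * _]mulrC.
Qed.

Hypotheses (omega01 : forall j, 0 <= omega j < 1)
  (omega_inj : injective omega) (x_neq0 : forall j, x j != 0)
  (le_sL : (s <= L)%N) (le_sML : (s <= (M - L).+1)%N).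

Lemma node_inj : injective (a 0).
Proof. by move=> j k; rewrite !mxE => /expi_2pi_inj e; apply/omega_inj/e. Qed.

(** In the transposed factorization the left factor, Vandermonde times an invertible diagonal, has
    full column rank because [s <= (M - L).+1], so it preserves the row space. *)
Lemma tr_hankel_eqmx : (H^T :=: (Vandermonde L.+1 a)^T)%MS.
Proof.
rewrite hankel_Vandermonde !trmx_mul trmxK tr_diag_mx mulmxA.
apply: eqmxMfull; rewrite /row_full mxrankMfree.
  by rewrite -mxrank_tr -/(row_free _) tr_Vandermonde_row_free //; apply: node_inj.
rewrite row_free_unit unitmxE unitfE det_diag.
by apply/prodf_neq0 => j _; rewrite mxE.
Qed.

Lemma rank_hankel : \rank H = s.
Proof.
rewrite -mxrank_tr tr_hankel_eqmx; apply/eqP; rewrite -/(row_free _).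
exact: tr_Vandermonde_row_free node_inj (leqW le_sL).
Qed.

Lemma phi_sub_hankel (w : R) : 0 <= w < 1 ->
  ((phi L w)^T <= H^T)%MS <-> range omega w.
Proof.
move=> w01; rewrite tr_hankel_eqmx.
have -> : (phi L w)^T = \row_(k < L.+1) node w ^+ k.
  by apply/rowP => k; rewrite !mxE expi_node.
rewrite submx_tr_Vandermonde //; split=> [[j]|[j _ <-]].
  by rewrite mxE => /expi_2pi_inj e; exists j => //; apply: e.
by exists j; rewrite mxE.
Qed.

End Hankel.

Theorem theorem1 (R : realType) (s L M : nat)
    (omega : 'I_s -> R) (x : 'I_s -> R[i])
    (U : 'M[R[i]]_L.+1) (sigma : nat -> R) (V : 'M[R[i]]_((M - L).+1))
    (s_gt0 : (0 < s)%N) (L_gt0 : (1 <= L)%N) (L_lt_M : (L < M)%N)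
    (omega01 : forall j, 0 <= omega j < 1)
    (x_neq0 : forall j, x j != 0)
    (omega_distinct : forall k l, k != l -> omega k != omega l)
    (s_le_L : (s <= L)%N) (s_le_ML : (s <= M - L + 1)%N)
    (svdH : is_svd (hankel L M (data omega x)) U sigma V)
    (w : R) (w01 : 0 <= w < 1) :
  (range omega w <-> noise_corr s U w = 0) /\
  (noise_corr s U w = 0 <-> imaging s U w = +oo%E).
Proof.
have omega_inj : injective omega.
  by move=> k l /eqP; apply: contraTeq => /omega_distinct.
rewrite addn1 in s_le_ML.
have corr0 : noise_corr s U w = 0 <-> norm2 (noise_proj s U *m phi L w) == 0.
  rewrite /noise_corr; split=> [/eqP|/eqP->]; last by rewrite mul0r.
  (* As the inverse of 0 is 0 by convention, the denominator must be excluded as a cause of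
     vanishing. *)
  by rewrite mulf_eq0 invr_eq0 (norm2_eq0 (phi L w)) (negbTE (phi_neq0 _ _)) orbF.
(* Outside the zero case [imaging] is a real number, hence not [+oo]. *)
split; last by rewrite corr0 /imaging; case: ifP.
rewrite corr0 norm2_eq0 -(rwP eqP) (noise_proj_kernel _ svdH) ?phi_sub_hankel //.
exact: rank_hankel.
Qed.
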